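(* Let $p$ be an odd prime, and assume that $2$ has order $g$ in the multiplicative group $\mathbb{Z}_p^*$ where $g$ is even. Let $n=2^{b}+2^{a}$ where $b>a\ge 0$ are integers and $n\ge 9$. If $\{a,b\}\equiv\{0,g/2\} \bmod g$ (that is, in some order, one of $a,b$ is congruent to $0$ and the other to $g/2$ modulo $g$), then $2^{a}$ is non-essential for $n$ in base $p$. Furthermore, the element $7$ is non-essential for $n$ in both base $2$ and base $p$. Hence $\Phi_{2p}$ is a factor of $Q_{n}(t)$.
   Context: For $S\subseteq[n-1]=\{1,\dots,n-1\}$ let $\beta_n(S)$ be the number of permutations $\pi\in\mathfrak{S}_n$ with descent set $\{i\in[n-1] : \pi_i>\pi_{i+1}\}$ equal to $S$. The $n$th descent set polynomial is $Q_n(t)=\sum_{S\subseteq[n-1]}t^{\beta_n(S)}$. $\Phi_m(t)$ denotes the $m$th cyclotomic polynomial; factors are in $\mathbb{Q}[t]$. For a prime $\ell$ and $1\le k\le n-1$, write $n=\sum_i n_i\ell^i$, $k=\sum_i k_i\ell^i$ with $0\le n_i,k_i<\ell$; $k$ is essential for $n$ in base $\ell$ if $k_i\le n_i$ for all $i$, and non-essential otherwise. *)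

(* Defs.v *)
From mathcomp Require Import all_boot all_order all_algebra all_fingroup all_field.

Set Implicit Arguments.
Unset Strict Implicit.
Unset Printing Implicit Defensive.

Import GRing.Theory.
Local Open Scope ring_scope.

Lemma ord_succ_proof n (i : 'I_n.-1) : (i.+1 < n)%N.
Proof. by rewrite -ltn_predRL. Qed.

(* Positions and subsets of [n-1] are indexed from 0: the index i : 'I_n.-1
   stands for i+1 in [n-1], and refers to the adjacent entries s_i, s_{i+1}
   of the 0-based word of s. *)
Definition descent_set n (s : 'S_n) : {set 'I_n.-1} :=
  [set i : 'I_n.-1 | (s (Ordinal (ord_succ_proof i)) < s (widen_ord (leq_pred n) i))%N].

Definition beta n (S : {set 'I_n.-1}) : nat :=
  #|[set s : 'S_n | descent_set s == S]|.

Definition descent_set_poly n : {poly rat} :=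
  \sum_(S : {set 'I_n.-1}) 'X^(@beta n S).

Definition digit (l n i : nat) : nat := ((n %/ l ^ i) %% l)%N.

Definition essential (l n k : nat) : Prop :=
  (0 < k < n)%N /\ forall i : nat, (digit l k i <= digit l n i)%N.

(* Non-essential is only meaningful for 1 <= k <= n-1. *)
Definition nonessential (l n k : nat) : Prop :=
  (0 < k < n)%N /\ ~ essential l n k.

(* Main.v *)
(* Each pairing of S with its symmetric difference with {2^a, 7} contributes a
   multiple of t^p + 1 to Q_n: toggling k in S changes beta_n(S) into
   -beta_n(S) modulo 'C(n, k), and p divides both 'C(n, 2^a) and 'C(n, 7), so
   toggling both elements preserves beta_n(S) modulo p. Toggling 7 also
   preserves parity, as 'C(n, 7) is even, whereas toggling 2^a flips it, because
   'C(2^b + 2^a, 2^a) and all the numbers beta_{2^m}(S) are odd. *)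
Require Import Defs.
From mathcomp Require Import all_boot all_order all_algebra all_fingroup all_field.
From mathcomp Require Import cyclic zify.

Set Implicit Arguments.
Unset Strict Implicit.
Unset Printing Implicit Defensive.

(** * Descent sets cut out by predicates on positions *)

(* D is 0-based, like the index set of descent_set. *)
Definition cut n (D : pred nat) : {set 'I_n.-1} := [set i : 'I_n.-1 | D i].

(** Every index set is a cut, so results phrased with predicates on [nat], which pass between
    different lengths without casts, cover all sets. *)
Lemma cut_val n (S : {set 'I_n.-1}) : cut n (mem (map val (enum S))) = S.
Proof.
by apply/setP=> i; rewrite inE /= (mem_map val_inj) mem_enum.
Qed.

Lemma mem_descent_set n (s : 'S_n) (i : 'I_n.-1) (x y : 'I_n) :
  x = i :> nat -> y = i.+1 :> nat -> (i \in descent_set s) = (s y < s x).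
Proof.
move=> xi yi; rewrite inE.
have -> : x = widen_ord (leq_pred n) i by apply: val_inj.
by have -> : y = Ordinal (ord_succ_proof i) by apply: val_inj.
Qed.

Lemma descent_set_cutP n (s : 'S_n) (D : pred nat) :
  reflect (forall x y : 'I_n, y = x.+1 :> nat -> (s y < s x) = D x)
          (descent_set s == cut n D).
Proof.
apply: (iffP eqP) => [eqS x y yx | eqS].
  have xn : x < n.-1 by have := ltn_ord y; lia.
  by rewrite -(@mem_descent_set _ s (Ordinal xn)) // eqS inE.
apply/setP=> i; rewrite (@mem_descent_set _ s i (widen_ord (leq_pred n) i)
  (Ordinal (ord_succ_proof i))) // inE.
exact: eqS.
Qed.


(** * Shuffles of two permutations along a set of values *)

(** [enum A] is increasing, so reading it through [nth] keeps the relative order; the defaults [x]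
    and [y] are never reached. *)
Lemma ltn_nth_enum n (A : {set 'I_n}) (x y : 'I_n) (i j : nat) :
  i < #|A| -> j < #|A| -> (nth x (enum A) i < nth y (enum A) j) = (i < j).
Proof.
rewrite !cardE => iA jA; rewrite (set_nth_default x y) //.
have srt : sorted (relpre val ltn) (enum A).
  rewrite -sorted_map {1}/enum_mem -enumT.
  rewrite sorted_map sorted_filter -?sorted_map ?val_enum_ord ?iota_ltn_sorted //.
  by move=> ? ? ? /=; apply: ltn_trans.
have mono := sorted_ltn_nth (fun y x z => @ltn_trans (val y) (val x) (val z)) x srt.
have [ij|ji|->] := ltngtP i j; last exact: ltnn.
  exact: mono.
by apply/negbTE; rewrite -leqNgt ltnW //; apply: mono.
Qed.

Section Riffle.
Variables k m : nat.
Implicit Type A : {set 'I_(k + m)}.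

(** Inverse of standardization: [A] holds the values at the first [k] positions, and [s1], [s2] give
    the relative orders of the two blocks. *)
Definition riffle_fun A (s1 : 'S_k) (s2 : 'S_m) (x : 'I_(k + m)) : 'I_(k + m) :=
  match split x with
  | inl i => nth x (enum A) (s1 i)
  | inr j => nth x (enum (~: A)) (s2 j)
  end.

Lemma riffle_fun_lshift A s1 s2 x i :
  #|A| = k -> riffle_fun A s1 s2 (lshift m i) = nth x (enum A) (s1 i).
Proof.
move=> cA; rewrite /riffle_fun (unsplitK (inl i)).
by apply: set_nth_default; rewrite -cardE cA.
Qed.

Lemma card_setC_riffle A : #|A| = k -> #|~: A| = m.
Proof. by move=> cA; rewrite cardsCs setCK cA card_ord addKn. Qed.

Lemma riffle_fun_rshift A s1 s2 x j :
  #|A| = k -> riffle_fun A s1 s2 (rshift k j) = nth x (enum (~: A)) (s2 j).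
Proof.
move=> cA; rewrite /riffle_fun (unsplitK (inr j)).
by apply: set_nth_default; rewrite -cardE card_setC_riffle.
Qed.

Lemma riffle_fun_mem A s1 s2 x :
  #|A| = k -> (riffle_fun A s1 s2 x \in A) = (x < k).
Proof.
move=> cA; rewrite /riffle_fun; case: splitP => i xi.
  by rewrite -mem_enum mem_nth // -cardE cA.
apply/negbTE; rewrite -in_setC -mem_enum mem_nth // -cardE.
by rewrite card_setC_riffle.
Qed.

Lemma ltn_riffle_fun_lshift A s1 s2 i j : #|A| = k ->
  (riffle_fun A s1 s2 (lshift m i) < riffle_fun A s1 s2 (lshift m j))
    = (s1 i < s1 j).
Proof.
move=> cA; rewrite !(@riffle_fun_lshift _ _ _ (lshift m i)) //.
by rewrite ltn_nth_enum ?cA.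
Qed.

Lemma ltn_riffle_fun_rshift A s1 s2 i j : #|A| = k ->
  (riffle_fun A s1 s2 (rshift k i) < riffle_fun A s1 s2 (rshift k j))
    = (s2 i < s2 j).
Proof.
move=> cA; rewrite !(@riffle_fun_rshift _ _ _ (rshift k i)) //.
by rewrite ltn_nth_enum ?card_setC_riffle.
Qed.

Lemma riffle_fun_inj A s1 s2 : #|A| = k -> injective (riffle_fun A s1 s2).
Proof.
move=> cA x y eq_xy.
have := riffle_fun_mem s1 s2 x cA; rewrite eq_xy riffle_fun_mem // => lt_xy.
move: lt_xy eq_xy; rewrite -(splitK x) -(splitK y).
case: (split x) => i; case: (split y) => j /=; rewrite ?ltn_ord; try lia.
  move=> _; rewrite !(@riffle_fun_lshift _ _ _ x) // => /eqP.
  by rewrite nth_uniq ?enum_uniq -?cardE ?cA // => /eqP/val_inj/perm_inj->.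
move=> _; rewrite !(@riffle_fun_rshift _ _ _ x) // => /eqP.
rewrite nth_uniq ?enum_uniq -?cardE ?card_setC_riffle //.
by move=> /eqP/val_inj/perm_inj->.
Qed.

(** [insubd] falls back to the identity when [riffle_fun] is not injective, which cannot happen for
    a set of size [k]. *)
Definition riffle (t : {set 'I_(k + m)} * 'S_k * 'S_m) : 'S_(k + m) :=
  insubd (1%g : {perm 'I_(k + m)}) [ffun x => riffle_fun t.1.1 t.1.2 t.2 x].

Lemma riffleE (t : {set 'I_(k + m)} * 'S_k * 'S_m) x :
  #|t.1.1| = k -> riffle t x = riffle_fun t.1.1 t.1.2 t.2 x.
Proof.
move=> cA; rewrite /riffle -[in LHS]pvalE insubdK ?ffunE //.
by apply: perm_proof; apply: riffle_fun_inj.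
Qed.

Definition riffle_dom := [set t : {set 'I_(k + m)} * 'S_k * 'S_m | #|t.1.1| == k].

(** The set is recovered as the values at the first [k] positions; the two orders follow because
    enumerations have no repetition. *)
Lemma riffle_inj : {in riffle_dom &, injective riffle}.
Proof.
move=> [[A s1] s2] [[B r1] r2]; rewrite !inE /= => /eqP cA /eqP cB eqAB.
have eqf x : riffle_fun A s1 s2 x = riffle_fun B r1 r2 x.
  by have /permP/(_ x) := eqAB; rewrite !riffleE.
have eqA : A = B.
  apply/setP=> y; have [g gK Kg] := injF_bij (@riffle_fun_inj A s1 s2 cA).
  by rewrite -(Kg y) riffle_fun_mem // eqf riffle_fun_mem.
rewrite -{}eqA {B cB} in eqAB eqf *; congr (_, _, _); apply/permP=> i.
  have /eqP := eqf (lshift m i); rewrite !(@riffle_fun_lshift _ _ _ (lshift m i)) //.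
  by rewrite nth_uniq ?enum_uniq -?cardE ?cA // => /eqP/val_inj.
have /eqP := eqf (rshift k i); rewrite !(@riffle_fun_rshift _ _ _ (rshift k i)) //.
by rewrite nth_uniq ?enum_uniq -?cardE ?card_setC_riffle // => /eqP/val_inj.
Qed.

Lemma card_riffle_dom (P : pred 'S_k) (Q : pred 'S_m) :
  #|[set t in riffle_dom | P t.1.2 && Q t.2]|
    = 'C(k + m, k) * #|[set s | P s]| * #|[set s | Q s]|.
Proof.
rewrite -[in 'C(_, _)](card_ord (k + m)) -card_draws -!cardsX.
by apply: eq_card => -[[A s1] s2]; rewrite !inE /= andbA.
Qed.

(** Injectivity suffices, since the domain has 'C(k + m, k) * k! * m! = (k + m)! elements. *)
Lemma riffle_surj : riffle @: riffle_dom = setT.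
Proof.
apply/eqP; rewrite eqEcard subsetT card_in_imset; last exact: riffle_inj.
have := card_riffle_dom predT predT.
rewrite !cardsT !card_Sn => eq_card; rewrite -(bin_fact (leq_addr m k)) addKn.
rewrite mulnA -eq_card /=; apply: subset_leq_card; apply/subsetP=> t.
by case/setIdP.
Qed.

Lemma card_riffle (R : pred 'S_(k + m)) (P : pred 'S_k) (Q : pred 'S_m) :
  {in riffle_dom, forall t, R (riffle t) = P t.1.2 && Q t.2} ->
  #|[set s | R s]| = 'C(k + m, k) * #|[set s | P s]| * #|[set s | Q s]|.
Proof.
move=> RPQ; rewrite -card_riffle_dom -(card_in_imset (f := riffle)).
  apply: eq_card => s; have /imsetP[t t_dom ->] : s \in riffle @: riffle_dom.
    by rewrite riffle_surj.
  rewrite inE RPQ //; apply/idP/imsetP=> [PQt | [t']].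
    by exists t; rewrite // inE t_dom.
  by rewrite inE => /andP[t'_dom PQt'] /riffle_inj->.
by move=> t t' /setIdP[t_dom _] /setIdP[t'_dom _]; apply: riffle_inj.
Qed.

End Riffle.

(** * Toggling one element of a descent set *)

(* The entries before and after position k standardize independently, so a
   permutation with descents prescribed away from k amounts to the set of its
   first k values and two smaller permutations with prescribed descents. *)
Lemma beta_toggle k m (D D' : pred nat) : 0 < k -> 0 < m ->
  (forall i, D' i = D i (+) (i == k.-1)) ->
  beta (cut (k + m) D) + beta (cut (k + m) D')
    = 'C(k + m, k) * beta (cut k D) * beta (cut m (fun i => D (k + i))).
Proof.
move=> k_gt0 m_gt0 DD'.
(* [R] leaves only the comparison at position [k.-1] free; [D] and [D'] are its two outcomes. *)
pose R := [pred s : 'S_(k + m) |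
  (descent_set s == cut (k + m) D) || (descent_set s == cut (k + m) D')].
have RE (s : 'S_(k + m)) : reflect
    (forall x y : 'I_(k + m), y = x.+1 :> nat -> x != k.-1 :> nat ->
      (s y < s x) = D x)
    (R s).
  apply: (iffP orP) => [[/descent_set_cutP dD | /descent_set_cutP dD] x y yx xk | dD].
  - exact: dD.
  - by rewrite dD // DD' (negbTE xk) addbF.
  have lt_kn : k < k + m by lia.
  have lt_pn : k.-1 < k + m by lia.
  pose x0 : 'I_(k + m) := Ordinal lt_pn; pose y0 : 'I_(k + m) := Ordinal lt_kn.
  have [d0 | d0] := eqVneq (s y0 < s x0) (D k.-1).
    left; apply/descent_set_cutP => x y yx; have [xk | /dD->//] := eqVneq (x : nat) k.-1.
    have -> : x = x0 by apply: val_inj.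
    by have -> : y = y0 by apply: val_inj; rewrite /= yx xk prednK.
  right; apply/descent_set_cutP => x y yx.
  have [xk | xk] := eqVneq (x : nat) k.-1; last by rewrite dD // DD' (negbTE xk) addbF.
  have -> : x = x0 by apply: val_inj.
  have -> : y = y0 by apply: val_inj; rewrite /= yx xk prednK.
  by rewrite DD' eqxx addbT; move: d0; case: (_ < _); case: (D _).
rewrite -(@card_riffle k m R); last first.
  move=> t; rewrite inE => /eqP cA.
  apply/idP/andP => [/RE dR | [/descent_set_cutP d1 /descent_set_cutP d2]].
    split; apply/descent_set_cutP => i j ji.
      rewrite -(@ltn_riffle_fun_lshift k m t.1.1 t.1.2 t.2) // -!riffleE //.
      by apply: dR => //=; have := ltn_ord j; lia.
    rewrite -(@ltn_riffle_fun_rshift k m t.1.1 t.1.2 t.2) // -!riffleE //.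
    by apply: dR => /=; lia.
  apply/RE => x y yx xk; rewrite !riffleE //.
  move: yx xk; rewrite -(splitK x) -(splitK y).
  (* Adjacent positions in different blocks must start at [k.-1], which [xk] excludes. *)
  case: (split x) => i; case: (split y) => j /= yx xk.
  - by rewrite ltn_riffle_fun_lshift // d1.
  - by have := ltn_ord i; lia.
  - by have := ltn_ord j; lia.
  by rewrite ltn_riffle_fun_rshift // d2 //; lia.
rewrite /beta -cardsUI [X in _ + X](_ : _ = 0) ?addn0.
  by apply: eq_card => s; rewrite !inE.
apply: eq_card0 => s; rewrite !inE; apply/andP=> -[/eqP-> /eqP/setP].
have lt_k : k.-1 < (k + m).-1 by lia.
by move/(_ (Ordinal lt_k)); rewrite !inE /= DD' eqxx; case: (D _).
Qed.

Definition toggle n (i : 'I_n) (S : {set 'I_n}) : {set 'I_n} :=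
  [set j | (j \in S) (+) (j == i)].

Lemma beta_toggle_set n (S : {set 'I_n.-1}) (i : 'I_n.-1) :
  let D := mem (map val (enum S)) in
  beta S + beta (toggle i S)
    = 'C(n, i.+1) * beta (cut i.+1 D)
      * beta (cut (n - i.+1) (fun j => D (i.+1 + j))).
Proof.
move=> D; have lt_i := ltn_ord i.
have le_i : i.+1 <= n by lia.
pose D' := fun j => D j (+) (j == i).
have -> : beta S + beta (toggle i S) = beta (cut n D) + beta (cut n D').
  rewrite cut_val; congr (_ + beta _); apply/setP => j; rewrite !inE /D'.
  by rewrite -[in LHS](cut_val S) inE.
have := @beta_toggle i.+1 (n - i.+1) D D'; rewrite subnKC //.
by apply=> //; rewrite subn_gt0; lia.
Qed.

(** * Parity of descent set numbers and binomial coefficients *)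

(** Without descents the word is increasing, and the increasing list of all values is unique. *)
Lemma descent_set_eq0 n (s : 'S_n) : descent_set s = set0 -> s = 1%g.
Proof.
move=> ds0.
have ws : sorted ltn [seq val (s i) | i <- enum 'I_n].
  apply/(sortedP 0) => i; rewrite size_map size_enum_ord => lt_i.
  have lt_i' := ltnW lt_i.
  rewrite !(nth_map (Ordinal lt_i)) -?enumT ?size_enum_ord //.
  set x := nth _ _ i; set y := nth _ _ i.+1.
  have xi : x = i :> nat by rewrite /x nth_enum_ord.
  have yi : y = i.+1 :> nat by rewrite /y nth_enum_ord.
  have lt_p : i < n.-1 by lia.
  have /setP/(_ (Ordinal lt_p)) := ds0.
  rewrite (@mem_descent_set _ s (Ordinal lt_p) x y) // inE => /negbT.
  rewrite -leqNgt leq_eqVlt => /orP[/eqP/val_inj/perm_inj xy | //].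
  by move: yi; rewrite -xy xi; lia.
have : [seq val (s i) | i <- enum 'I_n] = [seq val i | i <- enum 'I_n].
  apply: (irr_sorted_eq ltn_trans ltnn) => //.
    by rewrite val_enum_ord iota_ltn_sorted.
  move=> z; apply/mapP/mapP=> [[i _ ->] | [i _ ->]].
    by exists (s i); rewrite ?mem_enum.
  by exists (s^-1 i)%g; rewrite ?mem_enum // permKV.
move/eq_in_map => eq_s; apply/permP => i; rewrite perm1.
by apply/val_inj/eq_s; rewrite mem_enum.
Qed.

Lemma beta_set0 n : beta (set0 : {set 'I_n.-1}) = 1.
Proof.
rewrite /beta -(cards1 (1%g : 'S_n)); apply: eq_card => s; rewrite !inE.
apply/eqP/eqP => [/descent_set_eq0 // | ->].
by apply/setP=> i; rewrite !inE !perm1 /=; lia.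
Qed.

(** Gauss's lemma applied to k * 'C(n, k) = n * 'C(n - 1, k - 1). *)
Lemma dvdn_bin d n k : d %| n -> coprime d k -> 0 < k -> d %| 'C(n, k).
Proof.
case: k => // k dn dk _; rewrite -(Gauss_dvdr _ dk) -mul_bin_diag.
exact: dvdn_mulr.
Qed.

Lemma bin_exp2_even m k : 0 < k < 2 ^ m -> ~~ odd 'C(2 ^ m, k).
Proof.
case: k => // k /andP[_ lt_k]; apply/negP => oddC.
have : 2 ^ m %| k.+1 * 'C(2 ^ m, k.+1) by rewrite -mul_bin_diag dvdn_mulr.
by rewrite Gauss_dvdl ?coprimeXl ?coprime2n // gtnNdvd.
Qed.

(** Induction on the size of [S]: removing an element preserves parity because the binomial
    coefficient in [beta_toggle_set] is even, and the empty set gives 1. *)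
Lemma beta_exp2_odd n m (S : {set 'I_n.-1}) : n = 2 ^ m -> odd (beta S).
Proof.
move=> n_eq; subst n.
elim: {S}#|S| {-2}S (erefl #|S|) => [S /cards0_eq-> | c IHc S cS].
  by rewrite beta_set0.
have /card_gt0P[i iS] : 0 < #|S| by rewrite cS.
have cS' : #|S :\ i| = c by move: cS; rewrite (cardsD1 i) iS => -[].
have lt_i : i.+1 < 2 ^ m by have := ltn_ord i; lia.
have toggle_i : toggle i S = S :\ i.
  by apply/setP=> j; rewrite !inE; have [->|] := eqVneq j i; rewrite ?iS ?addbF.
move/(congr1 odd): (beta_toggle_set S i); rewrite toggle_i oddD !oddM.
by rewrite (negbTE (bin_exp2_even _)) ?lt_i //= (IHc _ cS') addbT => /negbFE.
Qed.

(** In Vandermonde's sum the term of index 0 is 1, and every other one has an even factor 'C(2 ^ b,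
    i) with 0 < i < 2 ^ b. *)
Lemma bin_exp2D_odd a b : a < b -> odd 'C(2 ^ b + 2 ^ a, 2 ^ a).
Proof.
move=> lt_ab; rewrite -binomial.Vandermonde big_ord_recl /= bin0 mul1n subn0 binn.
rewrite oddD /=.
elim/big_ind: _ => // [x y | i _]; first by rewrite oddD => /negbTE-> /negbTE->.
rewrite oddM (negbTE (bin_exp2_even _)) //=.
by rewrite (leq_ltn_trans (ltn_ord i)) // ltn_exp2l.
Qed.

(** * Divisibility by X^p + 1 and by cyclotomic polynomials *)

Import GRing.Theory.
Local Open Scope ring_scope.

(** For odd [n] the divisors of 2n are the d and 2d with d dividing n; cancelling X^n - 1 from
    X^(2n) - 1 leaves the product of the factors of index 2d. *)
Lemma Cyclotomic_dvd_XnD1 n : odd n ->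
  map_poly intr 'Phi_(2 * n) %| ('X^n + 1 : {poly rat}).
Proof.
move=> n_odd; have n_gt0 := odd_gt0 n_odd.
have divs : perm_eq (divisors (2 * n)) (divisors n ++ map (muln 2) (divisors n)).
  apply: uniq_perm; rewrite ?divisors_uniq //.
    rewrite cat_uniq divisors_uniq map_inj_uniq ?divisors_uniq => [|x y]; last by lia.
    rewrite andbT; apply/hasPn => _ /mapP[d _ ->]; rewrite -dvdn_divisors //.
    by apply/negP => /(dvdn_trans (dvdn_mulr d (dvdnn 2))); rewrite dvdn2 n_odd.
  move=> e; rewrite mem_cat -!dvdn_divisors ?muln_gt0 //.
  apply/idP/orP => [e_dv | [/dvdn_mull->// | /mapP[d]]]; last first.
    by rewrite -dvdn_divisors // => d_dv ->; rewrite dvdn_pmul2l.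
  have [e_odd | ] := boolP (odd e).
    by left; rewrite -(@Gauss_dvdr _ 2) // coprimen2.
  rewrite -dvdn2 => /dvdnP[d e_eq]; right; apply/mapP; exists d; last by lia.
  by rewrite -dvdn_divisors // -(@dvdn_pmul2l 2) // mulnC -e_eq.
have XnD1E : 'X^n + 1 = \prod_(d <- divisors n) 'Phi_(2 * d) :> {poly int}.
  have nz : 'X^n - 1 != 0 :> {poly int}.
    by rewrite -lead_coef_eq0 lead_coefXnsubC.
  apply: (mulfI nz); rewrite -(big_map (muln 2) xpredT (fun d => 'Phi_d)).
  rewrite -{2}prod_Cyclotomic // -big_cat -(perm_big _ divs).
  by rewrite prod_Cyclotomic ?muln_gt0 // mulnC exprM subr_sqr_1.
have n_dv : n \in divisors n by rewrite -dvdn_divisors.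
have : map_poly intr ('X^n + 1) = 'X^n + 1 :> {poly rat}.
  by rewrite rmorphD rmorph1 /= map_polyXn.
by rewrite XnD1E (big_rem n) //= rmorphM /= => <-; apply: dvdp_mulr.
Qed.

(** With f = e + p c, the parity condition makes c odd, so X^p + 1 divides (X^p)^c + 1. *)
Lemma dvdp_XnD1 (R : fieldType) p e f : e = f %[mod p] -> odd (e + f) ->
  'X^p + 1 %| ('X^e + 'X^f : {poly R}).
Proof.
wlog le_ef : e f / (e <= f)%N.
  move=> IH mod_ef odd_ef; case: (leqP e f) => [le|/ltnW le]; first exact: IH.
  by rewrite ['X^e + _]addrC; apply: IH => //; rewrite addnC.
move=> /esym/eqP; rewrite eqn_mod_dvd // => /dvdnP[c fE] oddef.
have {}fE : f = (e + p * c)%N by lia.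
have c_odd : odd c.
  by move: oddef; rewrite fE addnA addnn oddD odd_double oddM => /andP[].
have -> : 'X^e + 'X^f = 'X^e * (('X^p) ^+ c - (-1) ^+ c) :> {poly R}.
  by rewrite -signr_odd c_odd expr1 opprK mulrDr mulr1 -exprM -exprD -fE addrC.
by rewrite subrXX opprK; apply/dvdp_mull/dvdp_mulr.
Qed.

Lemma dvdp_descent_set_poly n p (f : {set 'I_n.-1} -> {set 'I_n.-1}) :
  involutive f ->
  (forall S, beta S = beta (f S) %[mod p]) ->
  (forall S, odd (beta S + beta (f S))) ->
  'X^p + 1 %| descent_set_poly n.
Proof.
move=> fK f_mod f_odd.
(* Doubling the sum pairs each [S] with [f S] without choosing orbit representatives; 2 is
   invertible in the rationals. *)
rewrite -(@dvdpZr _ 2) // scaler_nat mulr2n.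
rewrite {2}/descent_set_poly (reindex_inj (inv_inj fK)) -big_split /=.
apply: (big_ind (fun q => 'X^p + 1 %| q)) => [|x y|S _].
- exact: dvdp0.
- exact: dvdp_add.
- exact: dvdp_XnD1.
Qed.

(** * Arithmetic of n in bases 2 and p, and the double toggle *)

Theorem theorem5p5 (p g a b n : nat) (u : {unit 'F_p})
    (p_prime : prime p) (p_odd : odd p)
    (u_eq2 : FinRing.uval u = 2%:R%R) (u_order : #[u]%g = g) (g_even : ~~ odd g)
    (lt_ab : (a < b)%N) (n_eq : n = (2 ^ b + 2 ^ a)%N) (n_ge9 : (9 <= n)%N)
    (ab_mod : (a = 0 %[mod g] /\ b = g./2 %[mod g])
           \/ (a = g./2 %[mod g] /\ b = 0 %[mod g])) :
  [/\ nonessential p n (2 ^ a),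
      nonessential 2 n 7,
      nonessential p n 7
    & (map_poly intr 'Phi_(2 * p) %| descent_set_poly n)%R].
Proof.
have g_gt0 : (0 < g)%N by rewrite -u_order order_gt0.
have p_gt2 : (2 < p)%N by have := prime_gt1 p_prime; lia.
have u_mod x y : x = y %[mod g] -> (2%:R ^+ x = 2%:R ^+ y :> 'F_p).
  move=> eq_xy; rewrite -u_eq2 -!FinRing.val_unitX.
  by rewrite -(expg_mod_order u x) -(expg_mod_order u y) u_order eq_xy.
(* The element of order 2 of the cyclic group is -1, so p divides 2^a + 2^b. *)
have half : (2%:R ^+ g./2 = -1 :> 'F_p).
  have : (2%:R ^+ g./2 : 'F_p) ^+ 2 == 1.
    rewrite -exprM muln2 halfK (negbTE g_even) subn0 (u_mod _ 0) ?modnn ?mod0n //.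
  (* The root 1 is excluded because 0 < g/2 < g, so g does not divide g/2. *)
  rewrite sqrf_eq1 => /orP[|/eqP//]; rewrite -u_eq2 -FinRing.val_unitX => /eqP.
  rewrite -[RHS](FinRing.val_unit1 'F_p) => /val_inj/eqP.
  by rewrite -order_dvdn u_order gtnNdvd //; lia.
have p_dvd x : (p %| x)%N = (x%:R == 0 :> 'F_p).
  exact: dvdn_pcharf (pchar_Fp p_prime) x.
have p_dv_n : (p %| n)%N.
  rewrite p_dvd n_eq natrD !natrX.
  by case: ab_mod => [[/u_mod-> /u_mod->] | [/u_mod-> /u_mod->]];
    rewrite half expr0 ?addNr ?subrr.
have p_2a : coprime p (2 ^ a) by rewrite coprimeXr // coprimen2.
(* If p = 7, then 2^3 = 1 in ['F_p], so the even number g would divide 3. *)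
have p_7 : coprime p 7.
  rewrite prime_coprime // dvdn_prime2 //; apply/eqP => p7.
  move: g_even; have : (g %| 3)%N.
    rewrite -u_order order_dvdn; apply/eqP/val_inj.
    by rewrite /= FinRing.val_unitX /= u_eq2; clear -p7; subst p; apply/eqP.
  by rewrite dvdn_divisors // !inE => /orP[] /eqP->.
(* The lowest base [p] digit is 0 for [n] but nonzero for [k]. *)
have nonessential_p k : coprime p k -> (0 < k < n)%N -> nonessential p n k.
  move=> p_k k_n; split=> // -[_ /(_ 0)]; rewrite /digit expn0 !divn1.
  rewrite (eqP p_dv_n) leqn0 => /eqP/eqP; apply/negP.
  by rewrite -/(p %| k)%N -prime_coprime.
have lt_2a_2b : (2 ^ a < 2 ^ b)%N by rewrite ltn_exp2l.
have gt0_2a : (0 < 2 ^ a)%N by rewrite expn_gt0.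
have b_gt2 : (2 < b)%N.
  by rewrite ltnNge; apply/negP=> b_le2; have := leq_pexp2l (isT : 0 < 2)%N b_le2; lia.
have [q qE] : exists q, (2 ^ b = 8 * q)%N.
  by exists (2 ^ (b - 3))%N; rewrite -[8%N]/(2 ^ 3)%N -expnD subnKC.
(* For a = 0, Pascal's rule gives two even coefficients of 2^b; otherwise [n] is even and 7 is
   odd. *)
have bin7_even : ~~ odd 'C(n, 7).
  case: (a) n_eq => [|c] n_eq.
    rewrite n_eq addn1 binS oddD (negbTE (bin_exp2_even _)); last by lia.
    by apply: bin_exp2_even; lia.
  by rewrite -dvdn2 dvdn_bin // n_eq expnS; lia.
split.
- by apply: nonessential_p => //; lia.
- split=> [|[_ dig]]; first by lia.
  (* The three lowest bits of 7 are all 1, while those of [n] come from 2^a alone, as 8 divides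
     2^b. *)
  have := dig 2; have := dig 1; have := dig 0; rewrite /digit.
  rewrite -[(2 ^ 0)%N]/1%N -[(2 ^ 1)%N]/2%N -[(2 ^ 2)%N]/4%N n_eq qE.
  by case: (a) => [|[|[|c]]]; rewrite ?expnS; lia.
- by apply: nonessential_p => //; lia.
have lt_i : ((2 ^ a).-1 < n.-1)%N by lia.
have lt_j : (6 < n.-1)%N by lia.
pose i := Ordinal lt_i; pose j := Ordinal lt_j.
have i1 : i.+1 = (2 ^ a)%N by rewrite /= prednK.
have p_beta (k : 'I_n.-1) S : coprime p k.+1 -> (p %| beta S + beta (toggle k S))%N.
  by move=> p_k; rewrite beta_toggle_set !dvdn_mulr // dvdn_bin.
apply: dvdp_trans (Cyclotomic_dvd_XnD1 p_odd) _.
apply: (@dvdp_descent_set_poly n p (fun S => toggle j (toggle i S))) => S.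
- by apply/setP=> k; rewrite !inE; case: (k \in S); case: (k == i); case: (k == j).
(* Adding the value at the intermediate set [toggle i S] makes both sides 0 modulo [p]. *)
- apply/eqP; rewrite -(eqn_modDr (beta (toggle i S))).
  rewrite [X in _ == X %[mod _]]addnC.
  by rewrite (eqP (p_beta i S _)) ?i1 // (eqP (p_beta j _ _)).
(* The cut after 2^a entries leaves blocks of lengths 2^a and 2^b, so all three factors are odd. *)
have odd_i : odd (beta S + beta (toggle i S)).
  rewrite beta_toggle_set !oddM (@beta_exp2_odd _ a) // (@beta_exp2_odd _ b) i1.
    by rewrite n_eq bin_exp2D_odd.
  by rewrite n_eq addnK.
have even_j : ~~ odd (beta (toggle i S) + beta (toggle j (toggle i S))).
  by rewrite beta_toggle_set !oddM (negbTE bin7_even).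
by move: odd_i even_j; rewrite !oddD; do 3!case: (odd _).
Qed.
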